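(* For each $n\geq 2$ let $\delta$ be a uniformly random transition function of an automaton with state set $[n]$ and alphabet $\{a,b\}$, and let $\omega$ be the word $$\omega:=a^{\lceil \sqrt{n}\rceil}\,\bigl(b\,a^{\lceil \sqrt{n}\rceil}\bigr)^{\lceil \sqrt{\log_2 n}\rceil}.$$ Let $A:=\delta_\omega([n])$ be the set of states that can be reached by inputting $\omega$. Then $\mathbb{E}[|A|]=O(\sqrt{n/\log n})$ as $n\to\infty$.
   Context: $[n]=\{1,\dots,n\}$. A random automaton on state set $[n]$ with alphabet $\{a,b\}$ is given by a transition function $\delta:[n]\times\{a,b\}\to[n]$ chosen uniformly among all $n^{2n}$ such functions; equivalently, the values $\delta_c(x):=\delta(x,c)$, for $x\in[n]$, $c\in\{a,b\}$, are independent and uniform on $[n]$. For a word $\omega=\omega_1\omega_2\cdots\omega_m\in\{a,b\}^*$ put $\delta_\omega:=\delta_{\omega_m}\circ\cdots\circ\delta_{\omega_1}$ (letters are read from left to right), and for $B\subseteq[n]$ put $\delta_\omega(B):=\{\delta_\omega(x):x\in B\}$. For a word $u$ and an integer $m\ge 0$, $u^m$ is $u$ repeated $m$ times. *)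

(* Defs.v *)
From HB Require Import structures.
From mathcomp Require Import all_boot all_order all_algebra.
From mathcomp Require Import all_classical all_reals all_analysis.

Set Implicit Arguments.
Unset Strict Implicit.
Unset Printing Implicit Defensive.

Import Order.TTheory GRing.Theory Num.Theory.
Import numFieldNormedType.Exports.

Local Open Scope ring_scope.

Definition letter := bool.
Definition letter_a : letter := false.
Definition letter_b : letter := true.
Definition word := seq letter.

Definition wordX (u : word) (m : nat) : word := flatten (nseq m u).

(* The state set [n] = {1, ..., n} is encoded by 'I_n = {0, ..., n - 1}. *)
Definition automaton (n : nat) := {ffun 'I_n * letter -> 'I_n}.

Definition delta_word n (delta : automaton n) (w : word) (x : 'I_n) : 'I_n :=
  foldl (fun y c => delta (y, c)) x w.

Definition delta_image n (delta : automaton n) (w : word) (B : {set 'I_n}) :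
  {set 'I_n} := [set delta_word delta w x | x in B].

Definition uniform_expectation (R : realType) (T : finType) (X : T -> R) : R :=
  (\sum_(t : T) X t) / #|T|%:R.

Definition log2 (R : realType) (x : R) : R := ln x / ln 2.

(* Only applied to nonnegative reals, where the absolute value is harmless. *)
Definition ceiln (R : realType) (x : R) : nat := `|Num.ceil x|%N.

Definition omega (R : realType) (n : nat) : word :=
  let ak := wordX [:: letter_a] (ceiln (Num.sqrt (n%:R : R))) in
  ak ++ wordX (letter_b :: ak) (ceiln (Num.sqrt (log2 (n%:R : R)))).

Definition expected_image_size (R : realType) (n : nat) : R :=
  uniform_expectation
    (fun delta : automaton n => #|delta_image delta (omega R n) [set: 'I_n]|%:R).

(* Main.v *)
Require Import Defs.
From HB Require Import structures.
From mathcomp Require Import all_boot all_order all_algebra.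
From mathcomp Require Import all_classical all_reals all_analysis.
From mathcomp Require Import zify ring lra.

Set Implicit Arguments.
Unset Strict Implicit.
Unset Printing Implicit Defensive.

Import Order.TTheory GRing.Theory Num.Theory.
Import numFieldNormedType.Exports.

Local Open Scope ring_scope.

(** Write f, g for the maps of the letters a, b and F = f^k.  The reachable set is
    the m-th layer of the decreasing chain S_0 = F[T], S_(j+1) = F(g(S_j)).
    Reading the values of g layer by layer, innermost layer first, turns g
    bijectively into a uniform word y, and |S_(j+1)| becomes the number of distinct
    F-values among the first |S_j| letters of y: the sizes decrease by the number of
    collisions c(t) of a prefix of length t.  With N = |S_0|, two applications of
    Chebyshev's inequality show that c(t) is of order at least t^2 / N, up to an
    event of probability O(N / t^2).  Outside of such events at the dyadic scales
    t = m 2^i, the recursion t' <= t - t^2 / O(N) gives |S_m| = O(N / m), and summing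
    the exceptional contributions gives E|S_m| = O(m + N / m).  Applying this first
    with F = id and k steps of f, then with F = f^k and m steps, yields the bound. *)

(** * Averages over uniform words and Chebyshev's inequality *)

Section SequenceAverage.
Variables (R : realFieldType) (T : finType).
Implicit Types phi psi : seq T -> R.

(** Expectation of [phi] over a uniform word of length [q]. Drawing one letter at a time makes the
    independence of consecutive blocks ([avg_cat]) a plain induction. *)
Fixpoint avg q phi : R :=
  if q is q'.+1 then #|T|%:R^-1 * \sum_(x : T) avg q' (fun w => phi (x :: w))
  else phi [::].

Lemma ler_avg q phi psi :
  (forall w, size w = q -> phi w <= psi w) -> avg q phi <= avg q psi.
Proof.
elim: q phi psi => [|q IH] phi psi le_phi /=; first exact: le_phi.
rewrite ler_wpM2l ?invr_ge0 ?ler0n //.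
by apply: ler_sum => x _; apply: IH => w sw; apply: le_phi => /=; rewrite sw.
Qed.

Lemma eq_avg q phi psi :
  (forall w, size w = q -> phi w = psi w) -> avg q phi = avg q psi.
Proof.
by move=> e; apply/eqP; rewrite eq_le !ler_avg // => w sw; rewrite e.
Qed.

Lemma avgD q phi psi :
  avg q (fun w => phi w + psi w) = avg q phi + avg q psi.
Proof.
elim: q phi psi => [|q IH] phi psi //=.
by rewrite -mulrDr -big_split /=; congr *%R; apply: eq_bigr => x _; apply: IH.
Qed.

Lemma avgZ q c phi : avg q (fun w => c * phi w) = c * avg q phi.
Proof.
elim: q phi => [|q IH] phi //=.
rewrite [RHS]mulrCA [c * _]mulr_sumr; congr *%R.
by apply: eq_bigr => x _; apply: IH.
Qed.

Lemma avg_sum (I : finType) q (phi : I -> seq T -> R) :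
  avg q (fun w => \sum_i phi i w) = \sum_i avg q (phi i).
Proof.
elim: q phi => [|q IH] phi //=.
rewrite -mulr_sumr; congr *%R; rewrite exchange_big /=.
by apply: eq_bigr => x _; apply: (IH (fun i w => phi i (x :: w))).
Qed.

Lemma avg_cat p q phi :
  avg (p + q) phi = avg p (fun u => avg q (fun v => phi (u ++ v))).
Proof.
elim: p phi => [|p IH] phi //=.
by congr *%R; apply: eq_bigr => x _; apply: IH.
Qed.

Lemma sum_tuple_avg q phi : (0 < #|T|)%N ->
  \sum_(t : q.-tuple T) phi t = (#|T| ^ q)%:R * avg q phi.
Proof.
move=> T_gt0; elim: q phi => [|q IH] phi.
  rewrite expn0 mul1r (big_pred1 [tuple]) //= => t.
  by rewrite /= [t]tuple0; symmetry; apply/eqP.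
rewrite (reindex (fun p : T * q.-tuple T => [tuple of p.1 :: p.2])) /=; last first.
  exists (fun t => (thead t, [tuple of behead t])) => [[x t]|t] _ /=.
    by congr pair; apply: val_inj.
  by rewrite [RHS]tuple_eta.
rewrite -(pair_bigA _ (fun x (t : q.-tuple T) => phi (x :: t))) /=.
under eq_bigr => x _ do rewrite (IH (fun w => phi (x :: w))).
rewrite -mulr_sumr expnS natrM mulrACA.
by field; rewrite pnatr_eq0 -lt0n.
Qed.

Lemma avg_cst q c : (0 < #|T|)%N -> avg q (fun=> c) = c.
Proof.
move=> T_gt0; elim: q => [|q IH] //=; rewrite IH sumr_const -[c *+ _]mulr_natl.
by rewrite mulKf // pnatr_eq0 -lt0n.
Qed.

Lemma avg_take p q phi : (0 < #|T|)%N -> (p <= q)%N ->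
  avg q (fun w => phi (take p w)) = avg p phi.
Proof.
move=> T_gt0 /subnKC <-; rewrite avg_cat; apply: eq_avg => u su.
rewrite -[RHS](avg_cst (q - p)) //; apply: eq_avg => v _.
by rewrite take_size_cat.
Qed.

(** Second moment of a shifted binomial variable. The free shift [c] is what lets the induction run:
    a first letter in [A] turns [c] into [c + 1]. *)
Lemma avg_sqr_count q (A : {pred T}) c : (0 < #|T|)%N ->
  let p := #|A|%:R / #|T|%:R in
  avg q (fun w => ((count (mem A) w)%:R + c) ^+ 2) =
    q%:R * p * (1 - p) + (q%:R * p + c) ^+ 2.
Proof.
move=> T_gt0 p; elim: q c => [|q IH] c /=; first by ring.
rewrite (bigID (mem A)) /=.
rewrite (eq_bigr (fun=> q%:R * p * (1 - p) + (q%:R * p + (c + 1)) ^+ 2)); last first.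
  move=> x Ax; rewrite -IH; apply: eq_avg => w _.
  by rewrite Ax add1n -natr1; congr GRing.exp; ring.
rewrite [X in _ + X](eq_bigr (fun=> q%:R * p * (1 - p) + (q%:R * p + c) ^+ 2));
  last first.
  move=> x Ax; rewrite -IH; apply: eq_avg => w _.
  by rewrite (negbTE Ax) add0n.
rewrite !sumr_const.
have -> : #|[pred x | x \notin mem A]| = (#|T| - #|A|)%N.
  by rewrite -(cardC (mem A)) addKn; apply: eq_card => x; rewrite !inE.
rewrite -[X in _ * (X + _)]mulr_natl -[X in _ * (_ + X)]mulr_natl natrB ?max_card // -natr1 /p.
have : #|T|%:R != 0 :> R by rewrite pnatr_eq0 -lt0n.
move: (#|T|%:R : R) (#|A|%:R : R) (q%:R : R) => n a k n_neq0.
by field.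
Qed.

(** Chebyshev at half the mean [mu = q * p]: the variance [mu * (1 - p)] is at most [mu], so the
    probability is at most [4 / mu]. *)
Lemma count_lower_tail q (A : {pred T}) : (0 < q)%N -> (0 < #|A|)%N ->
  avg q (fun w => (2 * count (mem A) w * #|T| < q * #|A|)%N%:R) <=
    4 * #|T|%:R / (q%:R * #|A|%:R).
Proof.
move=> q_gt0 A_gt0; have T_gt0 : (0 < #|T|)%N := leq_trans A_gt0 (max_card _).
pose p : R := #|A|%:R / #|T|%:R; pose mu := q%:R * p.
have p_gt0 : 0 < p by rewrite divr_gt0 ?ltr0n.
have mu_gt0 : 0 < mu by rewrite mulr_gt0 ?ltr0n.
(* On the event the count is below [mu / 2], so its squared deviation exceeds [mu ^+ 2 / 4]. *)
apply: (@le_trans _ _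
  (avg q (fun w => 4 / mu ^+ 2 * ((count (mem A) w)%:R - mu) ^+ 2))).
  apply: ler_avg => w _; case: ltnP => [lt_w|_] /=; last first.
    by rewrite mulr_ge0 ?sqr_ge0 // divr_ge0 ?sqr_ge0.
  have {}lt_w : 2 * (count (mem A) w)%:R < mu.
    rewrite /mu /p mulrA ltr_pdivlMr ?ltr0n // -!natrM ltr_nat.
    by rewrite lt_w.
  rewrite mulrAC ler_pdivlMr ?exprn_gt0 //.
  have := ler0n R (count (mem A) w); nra.
rewrite avgZ (avg_sqr_count _ _ (- mu)) // -/p -/mu subrr expr0n /= addr0.
have -> : 4 * #|T|%:R / (q%:R * #|A|%:R) = 4 / mu :> R.
  have := lt0r_neq0 p_gt0; have := lt0r_neq0 mu_gt0; rewrite /mu /p.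
  have : #|T|%:R != 0 :> R by rewrite pnatr_eq0 -lt0n.
  move: (#|T|%:R : R) (#|A|%:R : R) (q%:R : R) => n a k n_neq0.
  by rewrite !mulf_eq0 !negb_or => /and3P[k0 a0 _] _; field; rewrite k0 a0 n_neq0.
have -> : 4 / mu ^+ 2 * (mu * (1 - p)) = 4 / mu * (1 - p).
  by field; rewrite gt_eqF.
apply: ler_piMr; first by rewrite divr_ge0 ?ltW.
by rewrite gerBl ltW.
Qed.
End SequenceAverage.

(** * Collisions of [F] along a word *)

Section Collisions.
Local Open Scope nat_scope.
Variables T K : eqType.
Variable F : T -> K.

Definition distinct (w : seq T) := size (undup (map F w)).

Definition coll (w : seq T) := size w - distinct w.

Lemma distinct_le_size w : distinct w <= size w.
Proof. by rewrite /distinct (leq_trans (size_undup _)) ?size_map. Qed.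

Lemma distinct_coll w : distinct w + coll w = size w.
Proof. by rewrite subnKC ?distinct_le_size. Qed.

Lemma coll_cons x w : coll (x :: w) = (F x \in map F w) + coll w.
Proof.
have := distinct_le_size w; rewrite /coll /distinct /=.
by case: ifP => /= _ le_w; rewrite ?subSS // subSn.
Qed.

Lemma coll_catC u v : coll (u ++ v) = coll (v ++ u).
Proof.
rewrite /coll /distinct !size_cat addnC; congr (_ - _).
by apply/perm_size/perm_undup => x; rewrite !map_cat !mem_cat orbC.
Qed.

(** Each letter of [v] whose value already occurs in [u] is a further collision. Moving [v] to the
    front allows induction on [v] with [u] fixed. *)
Lemma coll_cat u v :
  coll u + count (fun x => F x \in map F u) v <= coll (u ++ v).
Proof.
rewrite coll_catC; elim: v => [|x v IH] /=; first by rewrite addn0.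
rewrite coll_cons map_cat mem_cat; case: (F x \in map F u) IH => IH.
  by rewrite orbT add1n addnS.
by rewrite add0n (leq_trans IH) ?leq_addl.
Qed.

Lemma coll_take s t w : s <= t -> coll (take s w) <= coll (take t w).
Proof.
move=> le_st; rewrite -(subnKC le_st) takeD.
by apply: leq_trans (coll_cat _ _); apply: leq_addr.
Qed.

Lemma coll_filter (a : pred T) w : coll [seq x <- w | a x] <= coll w.
Proof.
elim: w => [|x w IH] //=; case: ifP => _; rewrite !coll_cons.
  apply: leq_add IH; case: (boolP (F x \in map F [seq x <- w | a x])) => //.
  case/mapP=> y; rewrite mem_filter => /andP[_ yw] ->.
  by rewrite map_f.
by rewrite (leq_trans IH) ?leq_addl.
Qed.
End Collisions.

(** * Letters lying in large fibers of [F] *)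

Section HeavyFibers.
Local Open Scope nat_scope.
Variables (T K : finType) (F : T -> K).
Hypothesis T_gt0 : 0 < #|T|.

Let n := #|T|.
Let N := #|F @: [set: T]|.

Definition fiber_card s := #|[pred x | F x == s]|.

Lemma card_preim_seq (s : seq K) : uniq s ->
  #|[pred x | F x \in s]| = \sum_(y <- s) fiber_card y.
Proof.
move=> s_uniq; under eq_bigr => y _ do rewrite /fiber_card -sum1_card big_mkcond.
rewrite exchange_big -sum1_card big_mkcond /=; apply: eq_bigr => x _.
rewrite !inE -big_mkcond /= sum1_count.
rewrite (eq_count (a2 := pred1 (F x))) => [|y]; last by rewrite !inE eq_sym.
by rewrite count_uniq_mem //; case: (_ \in _).
Qed.

Lemma image_card_gt0 : 0 < N.
Proof.
case/card_gt0P: T_gt0 => x _; apply/card_gt0P; exists (F x).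
by rewrite imset_f ?inE.
Qed.

(** The fiber of [x] has at least half of the average size [n / N]. *)
Definition heavy : pred T := fun x => n <= 2 * N * fiber_card (F x).

(** There are at most [N] light fibers, each smaller than [n / (2 * N)], so together they cover at
    most half of [T]. *)
Lemma card_heavy : n <= 2 * #|heavy|.
Proof.
pose s := [seq y <- enum (F @: [set: T]) | 2 * N * fiber_card y < n].
have s_uniq : uniq s by rewrite filter_uniq ?enum_uniq.
have light_s : #|[predC heavy]| = \sum_(y <- s) fiber_card y.
  rewrite -card_preim_seq //; apply: eq_card => x.
  by rewrite !inE mem_filter mem_enum imset_f ?inE // andbT ltnNge.
have : 2 * N * #|[predC heavy]| <= N * n.
  rewrite light_s big_distrr /=.
  apply: (@leq_trans (\sum_(y <- s) n)).
    rewrite [X in X <= _]big_seq [X in _ <= X]big_seq; apply: leq_sum => y.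
    by rewrite mem_filter => /andP[/ltnW].
  rewrite big_const_seq count_predT iter_addn_0 mulnC leq_mul2r.
  by rewrite size_filter /N cardE count_size orbT.
rewrite -mulnA mulnCA leq_pmul2l ?image_card_gt0 //.
have := cardC heavy; rewrite -/n; lia.
Qed.

(** Distinct values have disjoint fibers, and each value taken at a heavy letter has a fiber of size
    at least [n / (2 * N)]. *)
Lemma distinct_heavy w :
  n * distinct F [seq x <- w | heavy x] <= 2 * N * #|[pred x | F x \in map F w]|.
Proof.
set s := undup (map F [seq x <- w | heavy x]).
have le_s : #|[pred x | F x \in s]| <= #|[pred x | F x \in map F w]|.
  apply/subset_leq_card/fintype.subsetP => x; rewrite !inE mem_undup.
  case/mapP=> y; rewrite mem_filter => /andP[_ yw] ->; exact: map_f.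
apply: leq_trans (leq_mul (leqnn _) le_s).
rewrite card_preim_seq ?undup_uniq // big_distrr /=.
rewrite /distinct -/s -iter_addn_0 -(count_predT s) -big_const_seq.
rewrite [X in X <= _]big_seq [X in _ <= X]big_seq; apply: leq_sum => y.
rewrite mem_undup => /mapP[x]; rewrite mem_filter => /andP[hx _] ->.
exact: hx.
Qed.
End HeavyFibers.

(** * Lower tail of the number of collisions *)

Section CollisionTail.
Variables (R : realFieldType) (T K : finType) (F : T -> K).
Hypothesis T_gt0 : (0 < #|T|)%N.

Let n := #|T|.
Let N := #|F @: [set: T]|.

Lemma image_card_le : (N <= n)%N.
Proof. by rewrite /N (leq_trans (leq_imset_card _ _)) ?max_card. Qed.

Definition few_heavy h (u : seq T) : bool :=
  (2 * count (mem (heavy F)) u * n < h * #|heavy F|)%N.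

Definition few_hits h (u v : seq T) : bool :=
  let A := [pred x | F x \in map F u] in
  (2 * count (mem A) v * n < h * #|A|)%N.

Definition many_distinct h (u : seq T) : bool :=
  (h * n <= 16 * N * #|[pred x | F x \in map F u]|)%N.

(* If u has many heavy letters, they either collide among themselves or take so
   many distinct values that the fibers over u are hit often by v. *)
Lemma few_coll_cases h u v : (h <= N)%N ->
  (32 * N * coll F (u ++ v) < h ^ 2)%N ->
  few_heavy h u || many_distinct h u && few_hits h u v.
Proof.
move=> le_hN few; case: (boolP (few_heavy h u)) => //=; rewrite -leqNgt => hB.
have N_gt0 : (0 < N)%N := image_card_gt0 F T_gt0.
have hH := card_heavy F T_gt0; have hd := distinct_heavy F u.
have hc := coll_cat F u v; have hf := coll_filter F (heavy F) u.
have hdc := distinct_coll F [seq x <- u | heavy F x].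
rewrite size_filter in hdc.
rewrite /many_distinct /few_hits.
set M := #|[pred x | F x \in map F u]| in hd *.
rewrite -/n -/N in hH hd.
set B := count (mem (heavy F)) u in hB.
have eB : count (heavy F) u = B by apply: eq_count.
rewrite eB in hdc.
set d := distinct F _ in hd hdc; set c' := coll F [seq x <- u | heavy F x] in hf hdc.
set hits := count (mem [pred x | F x \in map F u]) v.
have eh : count (fun x => F x \in map F u) v = hits by apply: eq_count.
rewrite eh in hc.
have {}hB : (h <= 4 * B)%N.
  rewrite -(@leq_pmul2r n) //.
  apply: (@leq_trans (h * (2 * #|heavy F|))); first by rewrite leq_mul2l hH orbT.
  by rewrite mulnCA -[4%N]/(2 * 2)%N -!mulnA leq_mul2l mulnA.
have few' : (32 * N * c' < h ^ 2)%N.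
  apply: leq_ltn_trans few; rewrite leq_mul2l; lia.
(* Since [h <= 4 * (d + c')], a smaller [d] would force [h <= 8 * c'], hence
   [32 * N * c' >= 4 * N * h >= h ^ 2], against [few']. *)
have hd8 : (h <= 8 * d)%N.
  rewrite leqNgt; apply/negP => lt_d.
  have : (h <= 8 * c')%N by lia.
  nia.
have many : (h * n <= 16 * N * M)%N by nia.
rewrite many /= ltnNge; apply/negP => le_hits.
have few2 : (32 * N * hits < h ^ 2)%N.
  apply: leq_ltn_trans few; rewrite leq_mul2l; lia.
have : (h * h * n <= 32 * N * hits * n)%N by nia.
by rewrite leq_pmul2r // leqNgt mulnn few2.
Qed.

(** The word is split into independent halves [u] and [v], and 72 = 8 + 64. Too few heavy letters in
    [u] cost [4 * n / (h * #|heavy F|) <= 8 / h <= 8 * N / h ^ 2]. For fixed [u] with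
    [many_distinct], the union of the fibers over [u] has at least [h * n / (16 * N)] elements, so
    too few hits in [v] cost at most [64 * N / h ^ 2]. *)
Lemma coll_lower_tail h : (0 < h <= N)%N ->
  avg (h + h) (fun w => (32 * N * coll F w < h ^ 2)%N%:R) <=
    72 * N%:R / h%:R ^+ 2 :> R.
Proof.
move=> /andP[h_gt0 le_hN].
have N_gt0 : (0 < N)%N := image_card_gt0 F T_gt0.
have hR : 0 < h%:R :> R by rewrite ltr0n.
have NR : 0 < N%:R :> R by rewrite ltr0n.
have nR : 0 < n%:R :> R by rewrite ltr0n.
pose p (u : seq T) : R := avg h (fun v => (many_distinct h u && few_hits h u v)%:R).
have p_le u : p u <= 64 * N%:R / h%:R ^+ 2.
  rewrite /p; case: (boolP (many_distinct h u)) => [many|_] /=; last first.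
    by rewrite avg_cst // divr_ge0 ?mulr_ge0 ?sqr_ge0.
  have A_gt0 : (0 < #|[pred x | F x \in map F u]|)%N.
    move: many; rewrite /many_distinct; case: posnP => // ->.
    by rewrite muln0 leqn0 muln_eq0 (gtn_eqF h_gt0) (gtn_eqF T_gt0).
  apply: le_trans (count_lower_tail _ h_gt0 A_gt0) _.
  move: many; rewrite /many_distinct -(ler_nat R) !natrM -/n.
  have : 0 < #|[pred x | F x \in map F u]|%:R :> R by rewrite ltr0n.
  move: (#|[pred x | F x \in map F u]|%:R : R) (h%:R : R) hR (n%:R : R) nR
    (N%:R : R) NR => a k k_gt0 t t_gt0 m m_gt0 a_gt0 le_kt.
  rewrite ler_pdivrMr ?mulr_gt0 // [leRHS]mulrA.
  have -> : 64 * m / k ^+ 2 * k * a = 4 * (16 * m * a) / k.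
    by field; rewrite gt_eqF.
  rewrite ler_pdivlMr //; lra.
apply: (@le_trans _ _ (avg h (fun u => (few_heavy h u)%:R + 64 * N%:R / h%:R ^+ 2))).
  rewrite avg_cat; apply: ler_avg => u _.
  rewrite -[X in X + _](avg_cst h _ T_gt0) -lerBlDl; apply: le_trans (p_le u).
  rewrite lerBlDl /p -avgD; apply: ler_avg => v _.
  case: ltnP => [few|_]; last by rewrite addr_ge0 ?ler0n.
  have := few_coll_cases le_hN few.
  by case: (few_heavy h u) => /= [_|->]; rewrite ?lerDl ?add0r.
rewrite avgD avg_cst //.
have heavy_gt0 : (0 < #|heavy F|)%N.
  by have := card_heavy F T_gt0; case: posnP => // ->; rewrite leqNgt T_gt0.
have := count_lower_tail R h_gt0 heavy_gt0.
rewrite -/(few_heavy _ _) -/n.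
set P := avg _ _ => le_P.
have le_P' : P <= 8 * N%:R / h%:R ^+ 2.
  apply: le_trans le_P _; rewrite ler_pdivrMr ?mulr_gt0 ?ltr0n //.
  have := card_heavy F T_gt0; move: le_hN; rewrite -!(ler_nat R) natrM -/n.
  move: (#|heavy F|%:R : R) (h%:R : R) hR (n%:R : R) nR
    (N%:R : R) NR => a k k_gt0 t t_gt0 m m_gt0 le_km le_ta.
  have -> : 8 * m / k ^+ 2 * (k * a) = 4 * (m * (2 * a)) / k.
    by field; rewrite gt_eqF.
  rewrite ler_pdivlMr // -mulrA ler_pM2l //; nra.
have -> : 72 * N%:R / h%:R ^+ 2 = 8 * N%:R / h%:R ^+ 2 + 64 * N%:R / h%:R ^+ 2 :> R.
  by rewrite -!mulrA -mulrDl; congr (_ * _); ring.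
by rewrite lerD2r.
Qed.
End CollisionTail.

(** * The recursion for the layer sizes, driven by a word *)

Section CollisionChain.
Variables (R : realFieldType) (T K : finType) (F : T -> K).
Hypothesis T_gt0 : (0 < #|T|)%N.

Let n := #|T|.
Let N := #|F @: [set: T]|.

Definition chain_step (y : seq T) (t : nat) : nat := distinct F (take t y).

(** The exceptional event at scale [h]. The guard restricts it to prefixes no longer than [N], where
    the tail bound applies. *)
Definition few_at (y : seq T) (h : nat) : bool :=
  (h + h <= N)%N && (32 * N * coll F (take (h + h) y) < h ^ 2)%N.

Lemma chain_stepD y t : (t <= size y)%N ->
  (chain_step y t + coll F (take t y) = t)%N.
Proof. by move=> le_t; rewrite distinct_coll size_takel. Qed.

Lemma iter_chain_le y j t : (iter j (chain_step y) t <= t)%N.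
Proof.
elim: j => //= j IH; apply: leq_trans (distinct_le_size _ _) _.
by rewrite size_take_min (leq_trans (geq_minl _ _)).
Qed.

Lemma iter_chain_antimono y i j t : (i <= j)%N ->
  (iter j (chain_step y) t <= iter i (chain_step y) t)%N.
Proof. by move=> /subnK <-; rewrite iterD iter_chain_le. Qed.

(* Discrete form of: u' <= - u^2 / M implies u(j) <= M / j. *)
Lemma harmonic_step (M j u v : nat) :
  (v <= u -> M * v + u ^ 2 <= M * u -> j * u <= M -> j.+1 * v <= M)%N.
Proof.
case: (posnP u) => [-> | u_gt0 le_vu le_v le_u].
  by rewrite leqn0 => /eqP->; rewrite muln0.
have u_le : (u <= M)%N by nia.
have M_gt0 : (0 < M)%N := leq_trans u_gt0 u_le.
rewrite -(@leq_pmul2l (M * u)) ?muln_gt0 ?M_gt0 //.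
apply: (@leq_trans (u * j.+1 * (u * (M - u)))%N).
  rewrite [X in (X <= _)%N](_ : _ = u * j.+1 * (M * v))%N; last by lia.
  by rewrite leq_mul2l; apply/orP; right; nia.
have : (u * j.+1 <= M + u)%N by lia.
move=> /(leq_mul (leqnn (u * (M - u)))); nia.
Qed.

Lemma dyadic_scale m t : (0 < m)%N -> (2 * m <= t)%N ->
  exists2 i, (2 * (m * 2 ^ i) <= t)%N & (t < 4 * (m * 2 ^ i))%N.
Proof.
move=> m_gt0 le_mt; have d_gt0 : (0 < 2 * m)%N by rewrite muln_gt0.
have q_gt0 : (0 < t %/ (2 * m))%N by rewrite divn_gt0.
exists (trunc_log 2 (t %/ (2 * m))).
  by have := trunc_logP (ltnSn 1) q_gt0; rewrite leq_divRL // => ?; lia.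
have := trunc_log_ltn (t %/ (2 * m)) (ltnSn 1).
by rewrite ltn_divLR // expnS => ?; lia.
Qed.

(** The three terms match three cases for the final size [t]: it is below [2 * m]; no relevant scale
    is exceptional and the harmonic decay applies; or [t] is below [4 * h] for some exceptional
    scale [h]. *)
Lemma iter_chain_bound (y : seq T) m : (0 < m)%N -> (N <= size y)%N ->
  (iter m (chain_step y) N)%:R <= (2 * m)%:R + 512 * N%:R / m%:R +
    \sum_(i < N) (4 * (m * 2 ^ i))%:R * (few_at y (m * 2 ^ i))%:R :> R.
Proof.
move=> m_gt0 le_Ny; set t := iter m _ N; set tail := \sum_(i < N) _.
have tail_ge0 : 0 <= tail by apply: sumr_ge0 => i _; rewrite mulr_ge0.
have mid_ge0 : 0 <= 512 * N%:R / m%:R :> R by rewrite divr_ge0 ?mulr_ge0 ?ler0n.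
have [lt_tm|le_mt] := ltnP t (2 * m).
  have : t%:R <= (2 * m)%:R :> R by rewrite ler_nat ltnW.
  lra.
(* Only scales with [t < 4 * h] matter: every earlier size [u] is at least [t], so its own scale,
   with [u < 4 * h], is among them. *)
case: (boolP [exists i : 'I_N, few_at y (m * 2 ^ i) && (t < 4 * (m * 2 ^ i))%N]).
  case/existsP=> i /andP[few_i lt_t].
  have : t%:R <= tail.
    rewrite /tail (bigD1 i) //= few_i mulr1.
    have : t%:R <= (4 * (m * 2 ^ i))%:R :> R by rewrite ler_nat ltnW.
    have : 0 <= \sum_(j < N | j != i)
      (4 * (m * 2 ^ j))%:R * (few_at y (m * 2 ^ j))%:R :> R.
      by apply: sumr_ge0 => j _; rewrite mulr_ge0.
    lra.
  have : 0 <= (2 * m)%:R :> R by [].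
  lra.
rewrite negb_exists => /forallP no_few.
suff : (m * t <= 512 * N)%N.
  rewrite -(ler_nat R) !natrM => le_t.
  have : t%:R <= 512 * N%:R / m%:R :> R by rewrite ler_pdivlMr ?ltr0n // mulrC.
  have : 0 <= 2 * m%:R :> R by rewrite mulr_ge0.
  lra.
(* At the scale [2 * h <= u < 4 * h], a non-exceptional prefix has [h ^ 2 <= 32 * N * c], so
   [u ^ 2 <= 16 * h ^ 2 <= 512 * N * c]. *)
have many_coll j u : (j <= m)%N -> u = iter j (chain_step y) N ->
    (u ^ 2 <= 512 * N * coll F (take u y))%N.
  move=> le_jm def_u.
  have le_tu : (t <= u)%N by rewrite def_u iter_chain_antimono.
  have le_uN : (u <= N)%N by rewrite def_u iter_chain_le.
  have [i le_hu lt_uh] := dyadic_scale m_gt0 (leq_trans le_mt le_tu).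
  (* The range [i < N] misses no scale, since [i < 2 ^ i] and [2 * (m * 2 ^ i) <= N]. *)
  have lt_iN : (i < N)%N by have := ltn_expl i (ltnSn 1); nia.
  have := no_few (Ordinal lt_iN); rewrite /few_at /= (leq_ltn_trans le_tu lt_uh).
  rewrite andbT addnn -mul2n (leq_trans le_hu le_uN) /= -leqNgt => le_h.
  have le_c := coll_take F y le_hu.
  set h := (m * 2 ^ i)%N in le_hu lt_uh le_h le_c.
  set c := coll _ _ in le_h le_c; set c' := coll _ _ in le_c *.
  have : (512 * N * c <= 512 * N * c')%N by rewrite leq_mul2l le_c orbT.
  nia.
suff : forall j, (j <= m)%N -> (j * iter j (chain_step y) N <= 512 * N)%N by exact.
elim=> [|j IH] // lt_jm; apply: harmonic_step (IH (ltnW lt_jm)).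
  exact: (iter_chain_le y 1).
have := many_coll j _ (ltnW lt_jm) erefl; have := iter_chain_le y j N => /=.
move: (iter j _ N) => u le_uN.
have := chain_stepD (leq_trans le_uN le_Ny).
by move: (coll _ _) (chain_step y u) => c v <-; rewrite mulnDr leq_add2l.
Qed.

Lemma avg_few_at h : (0 < h)%N ->
  avg n (fun y => (few_at y h)%:R) <= 72 * N%:R / h%:R ^+ 2 :> R.
Proof.
move=> h_gt0; have [le_hN|lt_Nh] := leqP (h + h) N; last first.
  rewrite (eq_avg (psi := fun=> 0)) => [|y _]; last by rewrite /few_at leqNgt lt_Nh.
  by rewrite avg_cst // divr_ge0 ?mulr_ge0 ?sqr_ge0 ?ler0n.
have le_hn : (h + h <= n)%N := leq_trans le_hN (image_card_le F).
rewrite (eq_avg (psi := fun y =>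
  (32 * N * coll F (take (h + h) y) < h ^ 2)%N%:R)); last first.
  by move=> y _; rewrite /few_at le_hN.
rewrite (avg_take (fun w => (32 * N * coll F w < h ^ 2)%N%:R)) //.
apply: coll_lower_tail => //.
by rewrite h_gt0 (leq_trans _ le_hN) ?leq_addr.
Qed.

Lemma sum_half_pow k : \sum_(i < k) (2 ^+ i)^-1 <= 2 :> R.
Proof.
suff -> : \sum_(i < k) (2 ^+ i)^-1 = 2 - 2 / 2 ^+ k :> R.
  by rewrite gerBl divr_ge0 ?exprn_ge0 ?ler0n.
elim: k => [|k IH]; first by rewrite big_ord0 expr0 divr1 subrr.
rewrite big_ord_recr /= IH exprS; field.
by rewrite expf_neq0 // pnatr_eq0.
Qed.

(** The exceptional scale [h = m * 2 ^ i] contributes at most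
    [4 * h * 72 * N / h ^ 2 = 288 * N / h]. The geometric series sums this to [576 * N / m], and
    1088 = 512 + 576. *)
Lemma avg_iter_chain m : (0 < m)%N ->
  avg n (fun y => (iter m (chain_step y) N)%:R) <=
    (2 * m)%:R + 1088 * N%:R / m%:R :> R.
Proof.
move=> m_gt0; have m_gt0R : 0 < m%:R :> R by rewrite ltr0n.
pose tail (y : seq T) : R :=
  \sum_(i < N) (4 * (m * 2 ^ i))%:R * (few_at y (m * 2 ^ i))%:R.
apply: (@le_trans _ _
  (avg n (fun y => (2 * m)%:R + 512 * N%:R / m%:R + tail y))).
  apply: ler_avg => y sy; apply: iter_chain_bound => //.
  by rewrite sy image_card_le.
rewrite avgD avg_cst // -addrA lerD2l.
have -> : 1088 * N%:R / m%:R = 512 * N%:R / m%:R + 576 * N%:R / m%:R :> R by lra.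
rewrite lerD2l avg_sum.
apply: (@le_trans _ _ (\sum_(i < N) 288 * N%:R / m%:R * (2 ^+ i)^-1)).
  apply: ler_sum => i _; rewrite avgZ.
  have h_gt0 : (0 < m * 2 ^ i)%N by rewrite muln_gt0 m_gt0 expn_gt0.
  apply: le_trans (ler_wpM2l (ler0n _ _) (avg_few_at h_gt0)) _.
  rewrite !natrM natrX le_eqVlt; apply/orP; left; apply/eqP.
  have m_neq0 := lt0r_neq0 m_gt0R.
  have pow_neq0 : 2 ^+ i != 0 :> R by rewrite expf_neq0 ?pnatr_eq0.
  by field; rewrite m_neq0 pow_neq0.
rewrite -mulr_sumr; apply: le_trans (ler_wpM2l _ (sum_half_pow _)) _.
  by rewrite divr_ge0 ?mulr_ge0 ?ler0n.
by lra.
Qed.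
End CollisionChain.

(** * Coding a random map by a word, layer by layer *)

Lemma take_count_sorted (T : Type) (r : T -> nat) k (s : seq T) :
  sorted (fun x y => r y <= r x)%N s ->
  take (count (fun x => k <= r x)%N s) s = [seq x <- s | (k <= r x)%N].
Proof.
have r_trans : transitive (fun x y => r y <= r x)%N.
  by move=> y x z /= le_yx le_zy; apply: leq_trans le_yx.
elim: s => //= x s IH s_sorted; have s_sorted' := path_sorted s_sorted.
case: ifP => [le_k|/negbT lt_k]; first by rewrite add1n /= IH.
have low : all (predC (fun x => k <= r x)%N) s.
  apply: sub_all (order_path_min r_trans s_sorted) => y /= le_yx.
  by rewrite -ltnNge (leq_ltn_trans le_yx) // ltnNge.
move: low; rewrite all_predC has_count -eqn0Ngt => /eqP count0.
by rewrite count0 /=; apply/esym/size0nil; rewrite size_filter.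
Qed.

Section LayerCoding.
Variables (T : finType) (F : T -> T).

Let N := #|F @: [set: T]|.

Definition layer (g : T -> T) (j : nat) : {set T} :=
  iter j (fun B : {set T} => F @: (g @: B)) (F @: [set: T]).

Lemma layerS g j : layer g j.+1 = F @: (g @: layer g j).
Proof. by []. Qed.

(** One step is monotone for inclusion, and the first step stays inside the image of [F], which is
    layer 0. *)
Lemma layer_decr g i j : (i <= j)%N -> layer g j \subset layer g i.
Proof.
move=> /subnK <-; elim: (j - i)%N => // d IH; rewrite addSn.
apply: fintype.subset_trans IH.
elim: (d + i)%N => [|l IH] /=; first by rewrite imsetS ?subsetT.
by rewrite !imsetS.
Qed.

Definition layer_rank m g x := count (fun j => x \in layer g j) (iota 0 m.+1).

(** The layers decrease, so the indices of those containing [x] form an initial segment of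
    [0, ..., m], whose length is the rank. *)
Lemma layer_rankP m g j x : (j <= m)%N ->
  (x \in layer g j) = (j < layer_rank m g x)%N.
Proof.
move=> le_jm; rewrite /layer_rank; case: (boolP (x \in layer g j)) => x_j.
  have -> : m.+1 = (j.+1 + (m - j))%N by rewrite addSn subnKC.
  rewrite iotaD count_cat; apply/esym.
  have /[!all_count]/eqP-> : all (fun i => x \in layer g i) (iota 0 j.+1).
    apply/allP => i; rewrite mem_iota add0n ltnS => /= le_ij.
    exact: (fintype.subsetP (layer_decr g le_ij)).
  by rewrite size_iota leq_addr.
have -> : m.+1 = (j + (m.+1 - j))%N by rewrite subnKC // ltnW.
rewrite iotaD count_cat [X in (_ + X)%N](_ : _ = 0)%N.
  rewrite addn0; apply/esym/negbTE; rewrite -leqNgt.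
  by rewrite (leq_trans (count_size _ _)) ?size_iota.
apply/eqP; rewrite eqn0Ngt -has_count; apply/hasPn => i.
rewrite mem_iota add0n => /andP[le_ji _]; apply: contra x_j.
exact: (fintype.subsetP (layer_decr g le_ji)).
Qed.

Definition layer_order m g : seq T :=
  sort (fun x y => layer_rank m g y <= layer_rank m g x)%N (enum T).

Lemma mem_layer_order m g x : x \in layer_order m g.
Proof. by rewrite mem_sort mem_enum. Qed.

(** Sorted by decreasing rank, the elements of rank above [j], which are those of layer [j], come
    first. *)
Lemma take_layer_order m g j : (j <= m)%N ->
  take #|layer g j| (layer_order m g) =i layer g j.
Proof.
move=> le_jm x; pose r := layer_rank m g.
have -> : #|layer g j| = count (fun x => j < r x)%N (layer_order m g).
  rewrite (permP (permEl (perm_sort _ _))) enumT cardE size_filter.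
  by apply: eq_count => y; apply: layer_rankP.
rewrite take_count_sorted.
  by rewrite mem_filter mem_layer_order andbT -layer_rankP.
by apply: sort_sorted => y z; apply: leq_total.
Qed.

Lemma size_layer_code m (g : T -> T) : size (map g (layer_order m g)) == #|T|.
Proof. by rewrite size_map size_sort -cardE. Qed.

(* Listing T layer by layer, innermost first, makes every layer a prefix: the
   sizes of the layers then only depend on prefixes of the coded word. *)
Definition layer_code m (g : {ffun T -> T}) : #|T|.-tuple T :=
  Tuple (size_layer_code m g).

Lemma layer_code_prefix m (g : {ffun T -> T}) j : (j <= m)%N ->
  layer g j.+1 = [set y in map F (take #|layer g j| (layer_code m g))].
Proof.
move=> le_jm; rewrite layerS /= -map_take -map_comp; apply/setP => y.
rewrite -imset_comp inE; apply/imsetP/mapP => -[x x_j ->]; exists x => //.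
  by rewrite take_layer_order.
by rewrite take_layer_order in x_j.
Qed.

Lemma card_layer m (g : {ffun T -> T}) j : (j <= m)%N ->
  #|layer g j| = iter j (chain_step F (layer_code m g)) N.
Proof.
elim: j => // j IH lt_jm; rewrite (layer_code_prefix _ (ltnW lt_jm)).
rewrite iterS -IH ?(ltnW lt_jm) // /chain_step /distinct.
rewrite cardsE -(card_uniqP (undup_uniq _)).
by apply: eq_card => y; rewrite mem_undup.
Qed.

(** The word can be decoded: layer 0 does not depend on [g], and each next layer is read off a
    prefix whose length is the size of the current one. The layers fix the ranks, hence the order,
    hence the argument to which each letter belongs. *)
Lemma layer_code_inj m : injective (layer_code m).
Proof.
move=> g g' eq_code.
have eq_layer j : (j <= m)%N -> layer g j = layer g' j.
  elim: j => // j IH lt_jm; have le_jm := ltnW lt_jm.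
  by rewrite !(layer_code_prefix _ le_jm) IH // eq_code.
have eq_rank : layer_rank m g =1 layer_rank m g'.
  move=> x; apply: eq_in_count => j; rewrite mem_iota ltnS => /andP[_ le_jm].
  by rewrite eq_layer.
have eq_order : layer_order m g = layer_order m g'.
  by rewrite /layer_order (funext eq_rank).
have /= := congr1 val eq_code; rewrite eq_order => /eq_in_map eq_g.
by apply/ffunP => x; apply: eq_g; apply: mem_layer_order.
Qed.

(** The injective code maps between sets of equal size [#|T| ^ #|T|], so it is bijective and a
    uniform [g] yields a uniform word. *)
Lemma sum_card_layer (R : realFieldType) m : (0 < #|T|)%N -> (0 < m)%N ->
  \sum_(g : {ffun T -> T}) #|layer g m|%:R <=
    (#|T| ^ #|T|)%:R * ((2 * m)%:R + 1088 * N%:R / m%:R) :> R.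
Proof.
move=> T_gt0 m_gt0.
apply: le_trans (ler_wpM2l (ler0n _ _) (avg_iter_chain R F T_gt0 m_gt0)).
rewrite -sum_tuple_avg // (reindex (layer_code m)) /=.
  by apply: ler_sum => g _; rewrite (card_layer g (leqnn m)).
apply/onW_bij/inj_card_bij; first exact: layer_code_inj.
by rewrite card_tuple card_ffun.
Qed.
End LayerCoding.

(** * From automata and words to layers *)

Lemma delta_word_nseq n (delta : automaton n) c k x :
  delta_word delta (wordX [:: c] k) x = iter k (fun y => delta (y, c)) x.
Proof. by elim: k x => //= k IH x; rewrite IH -iterSr. Qed.

Lemma delta_word_cat n (delta : automaton n) u v x :
  delta_word delta (u ++ v) x = delta_word delta v (delta_word delta u x).
Proof. exact: foldl_cat. Qed.

Lemma delta_wordX n (delta : automaton n) u m x :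
  delta_word delta (wordX u m) x = iter m (delta_word delta u) x.
Proof. by elim: m x => //= m IH x; rewrite delta_word_cat IH -iterSr. Qed.

(** A uniform automaton is a pair of independent uniform maps, one for each letter. *)
Definition join_automaton n (p : {ffun 'I_n -> 'I_n} * {ffun 'I_n -> 'I_n}) :
    automaton n :=
  [ffun z : 'I_n * letter => if z.2 then p.2 z.1 else p.1 z.1].

Lemma join_automaton_bij n : bijective (@join_automaton n).
Proof.
exists (fun delta : automaton n =>
  ([ffun x => delta (x, letter_a)], [ffun x => delta (x, letter_b)])).
  by case=> f g; congr pair; apply/ffunP => x; rewrite !ffunE.
by move=> delta; apply/ffunP => -[x []]; rewrite !ffunE.
Qed.

Lemma layer_imset (T : finType) (F g : T -> T) m :
  layer F g m = [set iter m (F \o g) (F x) | x in [set: T]].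
Proof.
elim: m => // m IH; rewrite layerS IH.
by rewrite -imset_comp -imset_comp; apply: eq_imset.
Qed.

Definition block_word k m : word :=
  let ak := wordX [:: letter_a] k in ak ++ wordX (letter_b :: ak) m.

Lemma delta_image_join n (f g : {ffun 'I_n -> 'I_n}) k m :
  delta_image (join_automaton (f, g)) (block_word k m) [set: 'I_n] =
     layer (iter k f) g m.
Proof.
rewrite layer_imset; apply: eq_imset => x.
set ak := wordX [:: letter_a] k.
have ak_f y : delta_word (join_automaton (f, g)) ak y = iter k f y.
  by rewrite delta_word_nseq; apply: eq_iter => z; rewrite ffunE.
rewrite delta_word_cat ak_f delta_wordX; apply: eq_iter => y /=.
by rewrite -[LHS]/(delta_word _ ak _) ak_f ffunE.
Qed.

(** This lets the layer bound, taken with [F = id], control the image size of [iter k f], which is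
    the [N] of the second application. *)
Lemma layer_id (T : finType) (f : T -> T) k :
  layer id f k = [set iter k f x | x in [set: T]].
Proof. by rewrite layer_imset; apply: eq_imset => x; apply: eq_iter. Qed.

(** For fixed [f], summing over [g] gives a bound that is affine in the image size of [iter k f];
    summing over [f] then only needs the mean of that size. *)
Lemma uniform_image_bound (R : realType) n k m :
    (0 < n)%N -> (0 < k)%N -> (0 < m)%N ->
  uniform_expectation (fun delta : automaton n =>
      #|delta_image delta (block_word k m) [set: 'I_n]|%:R) <=
    (2 * m)%:R + 1088 * ((2 * k)%:R + 1088 * n%:R / k%:R) / m%:R :> R.
Proof.
move=> n_gt0 k_gt0 m_gt0; have T_gt0 : (0 < #|'I_n|)%N by rewrite card_ord.
have m_gt0R : 0 < m%:R :> R by rewrite ltr0n.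
pose P : R := (n ^ n)%:R.
have P_gt0 : 0 < P by rewrite ltr0n expn_gt0 n_gt0.
have card_aut : #|{: automaton n}|%:R = P * P.
  by rewrite card_ffun card_prod card_bool card_ord muln2 -addnn expnD natrM.
rewrite /uniform_expectation card_aut ler_pdivrMr ?mulr_gt0 //.
rewrite (reindex _ (onW_bij _ (@join_automaton_bij n))) /=.
rewrite -(pair_bigA _ (fun f g => #|delta_image (join_automaton (f, g))
  (block_word k m) [set: 'I_n]|%:R)) /=.
pose img (f : {ffun 'I_n -> 'I_n}) := #|layer id f k|.
apply: (@le_trans _ _ (\sum_f P * ((2 * m)%:R + 1088 * (img f)%:R / m%:R))).
  apply: ler_sum => f _.
  apply: (@le_trans _ _ (\sum_(g : {ffun 'I_n -> 'I_n}) #|layer (iter k f) g m|%:R)).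
    by apply: ler_sum => g _; rewrite delta_image_join.
  have := sum_card_layer (iter k f) R T_gt0 m_gt0.
  by rewrite /img layer_id card_ord.
rewrite -mulr_sumr [leRHS]mulrC -[leRHS]mulrA ler_pM2l // big_split /= sumr_const.
rewrite card_ffun card_ord -[X in X + _]mulr_natl -/P mulrDr lerD2l.
rewrite -mulr_suml -mulr_sumr mulrA [P * _]mulrC ler_pM2r ?invr_gt0 //.
have := sum_card_layer id R T_gt0 k_gt0.
rewrite imset_id cardsT card_ord -/P => le_sum.
by rewrite -[leRHS]mulrA ler_wpM2l ?ler0n // [leRHS]mulrC.
Qed.

(** * Numerical estimates and the asymptotic bound *)

Lemma ceiln_bounds (R : realType) (x : R) : 0 <= x ->
  x <= (ceiln x)%:R /\ (ceiln x)%:R <= x + 1.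
Proof.
move=> x_ge0; have c_ge0 : 0 <= Num.ceil x.
  by rewrite ceil_ge0 (lt_le_trans _ x_ge0) ?ltrN10.
have -> : (ceiln x)%:R = (Num.ceil x)%:~R :> R by rewrite /ceiln natr_absz ger0_norm.
split; first exact: ceil_ge.
by have := ceilB1_lt x; rewrite rmorphB /= mulr1z ltrBlDr => /ltW.
Qed.

(** Both follow from [ln (1 + x) <= x], at [x = 1] and [x = - 1 / 2]. *)
Lemma ln2_bounds (R : realType) : 1 / 2 <= ln 2 :> R /\ ln 2 <= 1 :> R.
Proof.
split; last by have := @le_ln1Dx R 1; apply; lra.
have := @le_ln1Dx R (- (1 / 2)).
have -> : 1 + - (1 / 2) = 2^-1 :> R by lra.
rewrite lnV ?posrE ?ltr0n // => /(_ ltac:(lra)); lra.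
Qed.

Lemma expected_image_size_le (R : realType) n : (2 <= n)%N ->
  expected_image_size R n <= (10 + 1088 * 1092) * Num.sqrt (n%:R / ln n%:R).
Proof.
move=> n_ge2; have n_ge2R : 2 <= n%:R :> R by rewrite ler_nat.
have [ln2_ge ln2_le] := ln2_bounds R.
have L_gt0 : 0 < ln n%:R :> R by apply: ln_gt0; lra.
pose x : R := Num.sqrt n%:R; pose l : R := Num.sqrt (ln n%:R).
have sqr_x : x ^+ 2 = n%:R by rewrite sqr_sqrtr.
have sqr_l : l ^+ 2 = ln n%:R by rewrite sqr_sqrtr // ltW.
have x_ge1 : 1 <= x by rewrite -[1]sqrtr1 ler_wsqrtr //; lra.
have l_gt0 : 0 < l by rewrite sqrtr_gt0.
have -> : Num.sqrt (n%:R / ln n%:R) = x / l by rewrite sqrtrM // sqrtrV // ltW.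
have l_le : l <= x.
  rewrite ler_wsqrtr //; have := @le_ln1Dx R (n%:R - 1).
  by rewrite [1 + _]addrC subrK => /(_ ltac:(lra)); lra.
(* [ln n = 2 * ln x <= 2 * (x - 1)]. *)
have sqr_l_le : l ^+ 2 <= 2 * x.
  have := @le_ln1Dx R (x - 1); rewrite [1 + _]addrC subrK => /(_ ltac:(lra)).
  by rewrite sqr_l -sqr_x lnXn ?mulr2n; lra.
have [] := ceiln_bounds (sqrtr_ge0 (n%:R : R)).
have [] := ceiln_bounds (sqrtr_ge0 (log2 (n%:R : R))).
rewrite /expected_image_size /omega -/x.
set m := ceiln (Num.sqrt (log2 _)); set k := ceiln x; move=> m_ge m_le k_ge k_le.
have log2_ge : l <= Num.sqrt (log2 n%:R).
  by rewrite ler_wsqrtr // /log2 ler_pdivlMr ?ler_piMr //; lra.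
have log2_le : Num.sqrt (log2 n%:R) <= 2 * l.
  have -> : 2 * l = Num.sqrt (4 * ln n%:R).
    by rewrite -sqr_l -[4](_ : 2 ^+ 2 = _) -?exprMn ?sqrtr_sqr ?ger0_norm //; lra.
  by rewrite ler_wsqrtr // /log2 ler_pdivrMr; nra.
have k_gt0R : 0 < k%:R :> R by lra.
have m_gt0R : 0 < m%:R :> R by lra.
have k_gt0 : (0 < k)%N by rewrite -(ltr0n R).
have m_gt0 : (0 < m)%N by rewrite -(ltr0n R).
apply: le_trans (uniform_image_bound R (ltnW n_ge2) k_gt0 m_gt0) _.
(* [m * l <= (2 * l + 1) * l = 2 * l ^+ 2 + l <= 4 * x + x]; doubling gives the 10 of the final
   constant. *)
have m_up : m%:R <= 5 * (x / l).
  rewrite mulrA ler_pdivlMr //; nra.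
have nk_le : n%:R / k%:R <= x by rewrite ler_pdivrMr // -sqr_x; nra.
(* 1092 = 4 + 1088, because [k <= x + 1 <= 2 * x]. *)
have sum_le : (2 * k)%:R + 1088 * n%:R / k%:R <= 1092 * x :> R.
  by rewrite natrM -mulrA; lra.
have xm_le : x / m%:R <= x / l.
  by rewrite ler_pM2l ?lef_pV2 ?posrE //; lra.
have : ((2 * k)%:R + 1088 * n%:R / k%:R) / m%:R <= 1092 * x / m%:R :> R.
  by rewrite ler_pM2r ?invr_gt0.
rewrite natrM; lra.
Qed.

Local Open Scope classical_set_scope.

Theorem theorem1p2 (R : realType) :
  (fun n : nat => expected_image_size R n)
    =O_\oo (fun n : nat => Num.sqrt (n%:R / ln n%:R) : R).
Proof.
apply/eqO_exP; exists (10 + 1088 * 1092); first lra.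
near=> n; have n_ge2 : (2 <= n)%N by near: n; exact: nbhs_infty_ge.
rewrite !ger0_norm ?sqrtr_ge0 //; first exact: expected_image_size_le.
by rewrite divr_ge0 ?ler0n // sumr_ge0.
Unshelve. all: by end_near.
Qed.
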